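(* Let $K\subseteq\mathbb{R}^n$ be a Euclidean cubical complex with initial vertex $\mathbf{0}\in K_0$. Let $\hat{K}\subset K$ be the subcomplex of points reachable from $\mathbf{0}$. If $\mathbf{v}\in\hat{K}_0$ is a vertex whose past link $lk^-_{\hat{K},\mathbf{0}}(\mathbf{v})$ in $\hat{K}$ is disconnected, then the space of directed paths $\overrightarrow{P}_{\mathbf{0}}^{\mathbf{v}}(K)$ is disconnected.
   Context: For $\mathbf{p},\mathbf{q}\in\mathbb{R}^n$ write $\mathbf{p}\preceq\mathbf{q}$ if $p_i\le q_i$ for all $i$, and $[\mathbf{p},\mathbf{q}]=\{\mathbf{x}\in\mathbb{R}^n:\mathbf{p}\preceq\mathbf{x}\preceq\mathbf{q}\}$. If $\mathbf{p},\mathbf{q}\in\mathbb{Z}^n$ and $\mathbf{q}-\mathbf{p}\in\{0,1\}^n$, then $[\mathbf{p},\mathbf{q}]$ is an elementary cube. A Euclidean cubical complex $K\subseteq\mathbb{R}^n$ is a union of elementary cubes; its vertex set $K_0$ is the set of integer points (elementary $0$-cubes) contained in $K$. A directed path (dipath) in $K$ is a continuous map $\alpha:[0,1]\to K$ each of whose coordinate functions is non-decreasing. For $\mathbf{x},\mathbf{y}\in K$, $\overrightarrow{P}_{\mathbf{x}}^{\mathbf{y}}(K)$ is the space of dipaths $\alpha$ in $K$ with $\alpha(0)=\mathbf{x}$ and $\alpha(1)=\mathbf{y}$, with the compact-open topology. A point $x\in K$ is reachable from a vertex $\mathbf{w}\in K_0$ if there is a dipath in $K$ from $\mathbf{w}$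 to $x$. The set $\hat K$ of points of $K$ reachable from $\mathbf{0}$ is a subcomplex of $K$ (a union of elementary cubes), and so is itself a Euclidean cubical complex. Let $\Delta^{n-1}$ be the full simplicial complex on the vertex set $\{1,\dots,n\}$; a simplex $S\subseteq\{1,\dots,n\}$ is identified with its indicator vector $\mathbf{j}\in\{0,1\}^n$ ($\mathbf{j}=\mathbf{0}$ corresponds to the empty simplex). The past link $lk^-_{K,\mathbf{w}}(\mathbf{v})$ of a vertex $\mathbf{v}$ with respect to a vertex $\mathbf{w}$ is the simplicial subcomplex of $\Delta^{n-1}$ given by: $\mathbf{j}\in lk^-_{K,\mathbf{w}}(\mathbf{v})$ if and only if $[\mathbf{v}-\mathbf{j},\mathbf{v}]\subseteq K\cap[\mathbf{w},\mathbf{v}]$; the same definition is used with $\hat K$ in place of $K$. Connectedness of a past link refers to its geometric realization. Disconnected means having at least two connected components (in particular the empty space is not disconnected). *)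

(* Defs.v *)
(* MathComp and MathComp-Analysis, over an arbitrary [R : realType]. *)
From mathcomp Require Import all_boot all_order all_algebra.
From mathcomp Require Import all_classical all_reals all_analysis.

Set Implicit Arguments.
Unset Strict Implicit.
Unset Printing Implicit Defensive.

Import Order.TTheory GRing.Theory Num.Theory.
Import numFieldNormedType.Exports.
Local Open Scope classical_set_scope.
Local Open Scope ring_scope.

(* At least two connected components for the subspace topology; in particular
   set0 is not disconnected. *)
Definition disconnected (T : topologicalType) (A : set T) : Prop :=
  exists x y, [/\ A x, A y & connected_component A x <> connected_component A y].

Section Complexes.
Context {R : realType} {n : nat}.
Implicit Types (x y : 'rV[R]_n) (p q v w : 'rV[int]_n) (K : set 'rV[R]_n)
  (S : {set 'I_n}).

Definition vle x y : Prop := forall i, x 0 i <= y 0 i.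

Definition box x y : set 'rV[R]_n := [set z | vle x z /\ vle z y].

(* The inclusion of Z^n in R^n. *)
Definition vecR v : 'rV[R]_n := map_mx intr v.

Definition elementary p q : Prop := forall i, (q - p) 0 i = 0 \/ (q - p) 0 i = 1.

Definition cubical_complex K : Prop :=
  exists2 C : set ('rV[int]_n * 'rV[int]_n),
    (forall c, C c -> elementary c.1 c.2) &
    K = \bigcup_(c in C) box (vecR c.1) (vecR c.2).

Definition vertices K : set 'rV[int]_n := [set v | K (vecR v)].

Definition indicator S : 'rV[int]_n := \row_i (i \in S)%:Z.

(* Simplices of \Delta^{n-1}, the empty one included, are subsets of 'I_n. *)
Definition past_link K w v : set {set 'I_n} :=
  [set S | box (vecR (v - indicator S)) (vecR v)
             `<=` K `&` box (vecR w) (vecR v)].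

Lemma past_link_sub K w v S S' :
  S' \subset S -> past_link K w v S -> past_link K w v S'.
Proof.
move=> /fintype.subsetP sS LS x [lx xu]; apply: LS; split=> // i.
apply: le_trans (lx i); rewrite !mxE ler_int lerD2l lerN2 lez_nat.
by case: (boolP (i \in S')) => // /sS ->.
Qed.

(* Geometric realization in barycentric coordinates: the union of the closed
   simplices of L, vertex i being the i-th basis vector of R^n. The empty
   simplex contributes no point. *)
Definition realization (L : set {set 'I_n}) : set 'rV[R]_n :=
  [set x | [/\ forall i, 0 <= x 0 i, \sum_i x 0 i = 1 &
     exists2 S, L S & forall i, i \notin S -> x 0 i = 0]].

End Complexes.

Arguments realization R {n} L.

Section DirectedPaths.
Context {R : realType}.

Definition unit_itv : set R := `[0, 1].

Lemma unit_itv0 : (0 : R) \in unit_itv.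
Proof. by rewrite inE /unit_itv /= in_itv /= lexx ler01. Qed.

Lemma unit_itv1 : (1 : R) \in unit_itv.
Proof. by rewrite inE /unit_itv /= in_itv /= lexx ler01. Qed.

Definition I0 : unit_itv := exist _ 0 unit_itv0.
Definition I1 : unit_itv := exist _ 1 unit_itv1.

Context {n : nat}.
Implicit Types (K : set 'rV[R]_n) (x y : 'rV[R]_n).

(* [set_type A] carries the subspace topology;
   the dipaths from x to y form a subspace of the space of maps between them
   with the compact-open topology. *)
Definition dipath K x y : set {compact-open, set_type unit_itv -> set_type K} :=
  [set a : set_type unit_itv -> set_type K |
    [/\ continuous a,
        forall s t : unit_itv, \val s <= \val t -> vle (\val (a s)) (\val (a t)),
        \val (a I0) = x & \val (a I1) = y]].

Arguments dipath K x y : clear implicits.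

Definition reachable K (w : 'rV[int]_n) : set 'rV[R]_n :=
  [set x | dipath K (vecR w) x !=set0].

End DirectedPaths.

Arguments dipath {R n} K x y.

(* Main.v *)
(* In a disconnected past link the vertices split into a class A and its
   complement, both nonempty, with no edge between them. Shortly before a dipath
   ends at v, the set S of the coordinates in which it has not yet reached v is
   a nonempty simplex of the past link, because the smallest cube containing a
   reachable point is reachable. S shrinks with time, so that it stays in A or
   in the complement of A; which of the two happens is an open condition on the
   dipath, and both happen: a dipath can end along the edge [v - e_i, v] for
   every vertex i of the link. *)
Require Import Defs.
From mathcomp Require Import all_boot all_order all_algebra.
From mathcomp Require Import all_classical all_reals all_analysis.
From mathcomp Require Import lra.

Set Implicit Arguments.
Unset Strict Implicit.

Import Order.TTheory GRing.Theory Num.Theory.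
Import numFieldNormedType.Exports.
Local Open Scope classical_set_scope.
Local Open Scope ring_scope.

(** * Continuity, connectedness and disconnection *)

Lemma row_continuous {R : realType} {n : nat} {T : topologicalType}
    (f : T -> 'rV[R]_n) :
  (forall i, continuous (fun x => f x 0 i)) -> continuous f.
Proof.
move=> fc x A [P fP sPA].
have : \forall y \near x, forall i, P 0 i (f y 0 i).
  by apply: filter_forall => i; exact: fc.
by apply: filterS => y Py; apply: sPA => j i; rewrite ord1.
Qed.

Lemma coord_comp_continuous {R : realType} {n : nat} {T : topologicalType}
    (f : T -> 'rV[R]_n) i :
  continuous f -> continuous (fun x => f x 0 i).
Proof.
by move=> fc x; apply: continuous_comp (fc x) (@coord_continuous _ _ _ _ _ _).
Qed.

Lemma segment_connected_component {R : realType} {n : nat}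
    (X : set 'rV[R]_n) (p q : 'rV[R]_n) :
  (forall t, 0 <= t <= 1 -> X (p + t *: (q - p))) -> connected_component X p q.
Proof.
move=> sX; pose f (t : R) := p + t *: (q - p).
exists (f @` `[0, 1]); last first.
  by exists 1; rewrite /= ?in_itv /= ?ler01 ?lexx // /f scale1r addrC subrK.
split.
- by exists 0; rewrite /= ?in_itv /= ?ler01 ?lexx // /f scale0r addr0.
- by move=> _ [t + <-]; rewrite /= in_itv => /sX.
- apply: connected_continuous_connected; first exact: segment_connected.
  apply: continuous_subspaceT => t; apply: cvgD; first exact: cvg_cst.
  by apply: cvgZr_tmp; exact: cvg_id.
Qed.

(** If a point of [U] and a point of [V] shared a component, its trace on [U] would be open and
    closed in it, hence all of it. *)
Lemma disconnected_open {T : topologicalType} (D U V : set T) :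
  open U -> open V -> D `<=` U `|` V -> D `&` U `&` V = set0 ->
  D `&` U !=set0 -> D `&` V !=set0 -> disconnected D.
Proof.
move=> oU oV DUV UV0 [x [Dx Ux]] [y [Dy Vy]]; exists x, y; split=> // exy.
have Cy : connected_component D x y.
  by rewrite exy; exact: connected_component_refl.
have sCD := @connected_component_sub _ D x.
have Cc := @component_connected _ D x.
have CUV : connected_component D x `&` U = connected_component D x `&` ~` V.
  apply/seteqP; split=> z [Cz Hz]; split=> //; have Dz := sCD _ Cz.
    by move=> Vz; have : (D `&` U `&` V) z by []; rewrite UV0.
  by have [] := DUV _ Dz.
have CU : connected_component D x `&` U = connected_component D x.
  apply: Cc.
  - by exists x; split=> //; exact: connected_component_refl.
  - by exists U.
  - by exists (~` V) => //; exact: open_closedC.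
move: Cy; rewrite -CU => -[_ Uy].
by have : (D `&` U `&` V) y by []; rewrite UV0.
Qed.

(** Take the identity below the floor [k] of [z] and, above it, the affine map fixing [k] and
    sending [z] to [w]. Integer bounds survive because no integer lies strictly between [k] and
    [z]. *)
Lemma floor_squeeze {R : realType} (z w : R) :
  (forall m : int, m%:~R <= z -> m%:~R <= w) ->
  (forall m : int, z <= m%:~R -> w <= m%:~R) ->
  exists f : R -> R, [/\ continuous f, {homo f : x y / x <= y}, f z = w &
    forall x (m : int), x <= z ->
      (m%:~R <= x -> m%:~R <= f x) /\ (x <= m%:~R -> f x <= m%:~R)].
Proof.
move=> lzw uzw; pose k : R := (Num.floor z)%:~R.
have kz : k <= z by exact: floor_le.
have kw : k <= w by exact: lzw.
(* For an integer [z] this is a division by zero, so [c] is 0 and [f] is constant above [k]. *)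
pose c := (w - k) / (z - k).
have c0 : 0 <= c by rewrite divr_ge0 // subr_ge0.
pose f x := Num.min x k + c * (Num.max x k - k).
have fz : f z = w.
  rewrite /f min_r // max_l //.
  have [zk|zk] := eqVneq z k.
    have wk : w = k by apply/le_anti; rewrite kw andbT; apply: uzw; rewrite -/k -zk.
    by rewrite zk wk subrr mulr0 addr0.
  by rewrite /c divfK ?subr_eq0 // addrC subrK.
have fh : {homo f : x y / x <= y}.
  move=> x y xy; rewrite /f lerD //.
    by rewrite le_min !ge_min xy lexx orbT.
  by rewrite ler_wpM2l // lerD2r ge_max !le_max xy lexx orbT.
exists f; split=> //.
  move=> x; apply: cvgD.
    by apply: (@continuous_min R R id (cst k)); [exact: cvg_id|exact: cvg_cst].
  apply: cvgM; first exact: cvg_cst.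
  apply: cvgB; last exact: cvg_cst.
  by apply: (@continuous_max R R id (cst k)); [exact: cvg_id|exact: cvg_cst].
move=> x m xz; have mk : m%:~R <= z -> m%:~R <= k.
  by rewrite /k ler_int floor_ge_int.
have fx : x <= k -> f x = x.
  by move=> xk; rewrite /f min_l // max_r // subrr mulr0 addr0.
split=> [mx|xm].
  have [/fx -> //|kx] := leP x k.
  apply: le_trans (mk (le_trans mx xz)) _.
  by rewrite /f (min_r (ltW kx)) (max_l (ltW kx)) lerDl mulr_ge0 // subr_ge0 ltW.
have [zm|/ltW/mk mk'] := leP z m%:~R.
  by apply: le_trans (fh _ _ xz) _; rewrite fz uzw.
by rewrite fx // (le_trans xm).
Qed.

(* The extension of a dipath beyond its ends makes reparametrization composition
   with a map R -> R. *)
Definition total_dipath {R : realType} {n : nat} (K : set 'rV[R]_n)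
    (x y : 'rV[R]_n) (g : R -> 'rV[R]_n) : Prop :=
  [/\ continuous g, forall s t, s <= t -> vle (g s) (g t), g 0 = x, g 1 = y &
      forall t, K (g t)].

(** * Passage between dipaths and their extensions to the line *)

Section TotalDipaths.
Context {R : realType} {n : nat}.
Implicit Types (K : set 'rV[R]_n) (x y : 'rV[R]_n) (g : R -> 'rV[R]_n).

Let I := set_type (@unit_itv R).

Lemma clamp_itv (t : R) : Num.min 1 (Num.max 0 t) \in @unit_itv R.
Proof. by rewrite inE /unit_itv /= in_itv /= le_min ge_min le_max ler01 !lexx. Qed.

Definition clamp (t : R) : I := exist (fun s => s \in @unit_itv R) _ (clamp_itv t).

Lemma clampE (t : I) : clamp (\val t) = t.
Proof.
apply/val_inj => /=; have := valP t; rewrite inE /unit_itv /= in_itv /= => /andP[t0 t1].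
by rewrite max_r // min_r.
Qed.

Lemma clamp_continuous : continuous clamp.
Proof.
apply: continuous_comp_initial => t /=.
apply: (@continuous_min R R (cst 1) (fun t => Num.max 0 t)); first exact: cvg_cst.
by apply: (@continuous_max R R (cst 0) id); [exact: cvg_cst|exact: cvg_id].
Qed.

Lemma dipath_total K x y (a : {compact-open, I -> set_type K}) :
  dipath K x y a ->
  exists2 g, total_dipath K x y g & forall t : I, g (\val t) = \val (a t).
Proof.
move=> [ac ah a0 a1]; exists (fun t => \val (a (clamp t))); last first.
  by move=> t; rewrite clampE.
split.
- move=> t; apply: (@continuous_comp _ _ _ clamp (fun s => \val (a s))).
    exact: clamp_continuous.
  apply: (@continuous_comp _ _ _ a \val); first exact: ac.
  exact: initial_continuous.
- move=> s t st; apply: ah => /=.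
  by rewrite le_min !ge_min lexx /= ge_max !le_max lexx st !orbT.
- by rewrite -[0]/(\val (@I0 R)) clampE.
- by rewrite -[1]/(\val (@I1 R)) clampE.
- by move=> t; have := valP (a (clamp t)); rewrite inE.
Qed.

Lemma total_dipath_restrict K x y g :
  total_dipath K x y g ->
  exists2 a : {compact-open, I -> set_type K},
    dipath K x y a & forall t : I, \val (a t) = g (\val t).
Proof.
move=> [gc gh g0 g1 gK].
exists (fun t : I =>
  exist (fun z => z \in K) _ (mem_set (gK (\val t))) : set_type K) => //.
split=> //.
- apply: continuous_comp_initial => t.
  apply: (@continuous_comp _ _ _ (\val : I -> R) g); last exact: gc.
  exact: initial_continuous.
- by move=> s t st /=; exact: gh.
Qed.

Lemma reachableP K (w : 'rV[int]_n) x :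
  reachable K w x <-> exists g, total_dipath K (vecR w) x g.
Proof.
split=> [[a /dipath_total[g ? _]]|[g /total_dipath_restrict[a ? _]]].
  by exists g.
by exists a.
Qed.

End TotalDipaths.

(** * Reachable points and the past link *)

Section Reachability.
Context {R : realType} {n : nat}.
Implicit Types (K : set 'rV[R]_n) (x y z w d : 'rV[R]_n) (g : R -> 'rV[R]_n)
  (u v : 'rV[int]_n).

Lemma total_dipath_le K x y g t : total_dipath K x y g -> 0 <= t <= 1 ->
  vle x (g t) /\ vle (g t) y.
Proof. by move=> [_ gh <- <- _] /andP[t0 t1]; split; exact: gh. Qed.

Lemma total_dipath_reachable K u y g t :
  total_dipath K (vecR u) y g -> 0 <= t -> reachable K u (g t).
Proof.
move=> [gc gh g0 _ gK] t0; apply/reachableP; exists (fun s => g (t * s)); split.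
- move=> s; apply: (@continuous_comp _ _ _ (fun s => t * s) g); last exact: gc.
  by apply: cvgM; [exact: cvg_cst|exact: cvg_id].
- by move=> r s rs; apply: gh; exact: ler_wpM2l.
- by rewrite mulr0.
- by rewrite mulr1.
- by [].
Qed.

Lemma reachable_ge K u z : reachable K u z -> vle (vecR u) z.
Proof.
move=> /reachableP[g gP]; have [_ _ _ <- _] := gP.
by have [] := total_dipath_le (t := 1) gP; rewrite ?ler01 ?lexx.
Qed.

Lemma reachable_sub K u : reachable K u `<=` K.
Proof. by move=> z /reachableP[g [_ _ _ <-]]; exact. Qed.

(* The hypotheses on [w] say that it lies in the smallest elementary cube
   containing [z]. A dipath ending at [z] is pushed to one ending at [w] by
   monotone maps of the coordinates which preserve each cube below [z]. *)
Lemma reachable_cube K u z w : cubical_complex K -> reachable K u z ->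
  (forall i (m : int), m%:~R <= z 0 i -> m%:~R <= w 0 i) ->
  (forall i (m : int), z 0 i <= m%:~R -> w 0 i <= m%:~R) ->
  reachable K u w.
Proof.
move=> [C _ KC] uz lzw uzw; have uz' := reachable_ge uz.
have /reachableP[g gP] := uz; have [gc gh g0 g1 gK] := gP.
have [f fP] := choice (fun i => floor_squeeze (lzw i) (uzw i)).
(* Stopping at time 1 keeps the path below [z], where the maps [f i] respect integer bounds. *)
pose q (t : R) := Num.min 1 t.
have qc : continuous q.
  by move=> t; apply: (@continuous_min R R (cst 1) id); [exact: cvg_cst|exact: cvg_id].
pose h t := \row_i f i (g (q t) 0 i).
have gz t i : g (q t) 0 i <= z 0 i.
  by rewrite -g1; apply: gh; rewrite ge_min lexx.
apply/reachableP; exists h; split.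
- apply: row_continuous => i t.
  rewrite (_ : (fun _ => _) = f i \o (fun s => g s 0 i) \o q); last first.
    by apply/funext => s; rewrite /= mxE.
  have [fc _ _ _] := fP i; apply: continuous_comp; first exact: qc.
  by apply: continuous_comp; [exact: coord_comp_continuous|exact: fc].
- move=> s t st i; rewrite !mxE; have [_ fh _ _] := fP i; apply: fh; apply: gh.
  by rewrite /q le_min !ge_min lexx st orbT.
- apply/rowP => i; rewrite !mxE /q min_r ?ler01 // g0.
  (* An integer below [z 0 i] is bounded by itself on both sides, so [f i] fixes it. *)
  have [_ _ _ /(_ (vecR u 0 i) (u 0 i) (uz' i))[fl fr]] := fP i.
  by apply/le_anti; move: fl fr; rewrite !mxE => -> // ->.
- by apply/rowP => i; rewrite mxE /q minxx g1; have [] := fP i.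
- move=> t; have := gK (q t); rewrite {1}KC => -[c Cc [cl cu]].
  rewrite KC; exists c => //; split=> i; rewrite [h t _ _]mxE.
    move: (cl i); rewrite !mxE; have [_ _ _ fm] := fP i.
    by have [] := fm _ (c.1 0 i) (gz t i).
  move: (cu i); rewrite !mxE; have [_ _ _ fm] := fP i.
  by have [] := fm _ (c.2 0 i) (gz t i).
Qed.

(** The smallest cube containing [z] has top vertex [v] and extends by 1 in exactly the coordinates
    where [z] is below [v], so it contains the cube of [S]; [reachable_cube] then applies. *)
Lemma past_link_near K u v z (S : {set 'I_n}) : cubical_complex K -> reachable K u z ->
  vle z (vecR v) -> (forall i, (v 0 i)%:~R - 1 < z 0 i) ->
  (forall i, i \in S -> z 0 i < (v 0 i)%:~R) ->
  past_link (reachable K u) u v S.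
Proof.
move=> cK uz zv vz Sz w [lw wv].
suff uw : reachable K u w by split=> //; split=> //; exact: reachable_ge uw.
apply: (reachable_cube cK uz) => i m.
  move=> mz; apply: le_trans (lw i); rewrite !mxE ler_int.
  have mv : m <= v 0 i.
    by rewrite -(ler_int R) (le_trans mz) //; have := zv i; rewrite mxE.
  case: (boolP (i \in S)) => iS; last by rewrite subr0.
  by rewrite lerBrDr lezD1 -(ltr_int R) (le_lt_trans mz) // Sz.
move=> zm; apply: le_trans (wv i) _; rewrite mxE ler_int -(ltzD1) -(ltr_int R).
by rewrite intrD -ltrBlDr (lt_le_trans (vz i)).
Qed.

(** The path [g] runs at double speed until time 1/2, then the segment does; 3/4 is the time of its
    midpoint. *)
Lemma total_dipath_append K x y d g : total_dipath K x y g ->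
  (forall i, 0 <= d 0 i) -> (forall s : R, 0 <= s <= 1 -> K (y + s *: d)) ->
  exists2 h, total_dipath K x (y + d) h & h (3 / 4) = y + 2^-1 *: d.
Proof.
move=> [gc gh g0 g1 gK] d0 Kd.
(* Clock [q] stops when clock [p] starts, so the concatenation is a sum of two continuous maps. *)
pose p (t : R) := Num.max 0 (Num.min 1 (2 * t - 1)).
pose q (t : R) := Num.min 1 (2 * t).
have c2 : continuous (fun t : R => 2 * t).
  by move=> t; apply: cvgM; [exact: cvg_cst|exact: cvg_id].
have pc : continuous p.
  move=> t; apply: (@continuous_max R R (cst 0) (fun t => Num.min 1 (2 * t - 1))).
    exact: cvg_cst.
  apply: (@continuous_min R R (cst 1) (fun t => 2 * t - 1)); first exact: cvg_cst.
  by apply: cvgB; [exact: c2|exact: cvg_cst].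
have qc : continuous q.
  by move=> t; apply: (@continuous_min R R (cst 1)); [exact: cvg_cst|exact: c2].
have p01 (t : R) : 0 <= p t <= 1.
  by rewrite /p le_max lexx /= ge_max ler01 ge_min lexx.
have pE (t : R) : 1 <= 2 * t <= 2 -> p t = 2 * t - 1.
  by move=> /andP[t1 t2]; rewrite /p min_r ?max_r //; lra.
have p0 (t : R) : 2 * t <= 1 -> p t = 0.
  by move=> t1; rewrite /p max_l // ge_min; apply/orP; right; lra.
have q1 (t : R) : 1 <= 2 * t -> q t = 1 by move=> t1; rewrite /q min_l.
exists (fun t => g (q t) + p t *: d); last first.
  have -> : q (3 / 4) = 1 by apply: q1; lra.
  have -> : p (3 / 4) = 2^-1 by rewrite pE; lra.
  by rewrite g1.
split.
- move=> t; apply: cvgD; first exact: (continuous_comp (qc t) (gc _)).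
  by apply: cvgZr_tmp; exact: pc.
- move=> s t st i; rewrite !mxE lerD //.
    by apply: gh; rewrite /q le_min !ge_min lexx /= ler_wpM2l ?orbT.
  apply: ler_wpM2r => //; rewrite /p ge_max le_max lexx /= le_max le_min !ge_min.
  by rewrite lexx /= lerD2r ler_wpM2l // !orbT.
- by rewrite p0 ?mulr0 // scale0r addr0 /q mulr0 min_r.
- have -> : q 1 = 1 by apply: q1; lra.
  have -> : p 1 = 1 by rewrite pE; lra.
  by rewrite g1 scale1r.
- move=> t; have [t1|/ltW t1] := leP (2 * t) 1.
    by rewrite p0 // scale0r addr0.
  by rewrite q1 // g1; exact: Kd.
Qed.

End Reachability.

(* A simplex of the realization is convex, so the vertices fall into those
   in the component of a given point and the others, and no edge joins them. *)
Lemma realization_disconnected_split {R : realType} {n : nat}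
    (L : set {set 'I_n}) :
  (forall S S' : {set 'I_n}, S' \subset S -> L S -> L S') ->
  disconnected (realization R L) ->
  exists A : set 'I_n, [/\ exists2 a, A a & L [set a]%SET,
    exists2 b, ~ A b & L [set b]%SET &
    forall a b, A a -> ~ A b -> ~ L [set a; b]%SET].
Proof.
move=> Lsub; set X := realization R L => -[x [y [Xx Xy xy]]].
have e0 (i j : 'I_n) : (delta_mx 0 i : 'rV[R]_n) 0 j = (i == j)%:R.
  by rewrite mxE eqxx eq_sym.
have seg S (p : 'rV[R]_n) i : L S -> i \in S -> (forall j, 0 <= p 0 j) ->
    \sum_j p 0 j = 1 -> (forall j, j \notin S -> p 0 j = 0) ->
    connected_component X p (delta_mx 0 i).
  move=> LS iS p0 p1 pS; apply: segment_connected_component => t /andP[t0 t1].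
  have pt j : (p + t *: (delta_mx 0 i - p)) 0 j =
      (1 - t) * p 0 j + t * (i == j)%:R by rewrite -e0 !mxE; lra.
  split.
  - by move=> j; rewrite pt addr_ge0 // mulr_ge0 // subr_ge0.
  - under eq_bigr do rewrite pt.
    rewrite big_split /= -!mulr_sumr p1 (bigD1 i) //= eqxx big1.
      by rewrite addr0 !mulr1 subrK.
    by move=> j /negPf ji; rewrite eq_sym ji.
  - exists S => // j jS; rewrite pt pS // mulr0 add0r.
    by case: eqVneq jS => [<-|]; rewrite ?iS // mulr0.
have vert (p : 'rV[R]_n) : X p ->
    exists2 i, connected_component X p (delta_mx 0 i) & L [set i]%SET.
  move=> [p0 p1 [S LS pS]].
  (* The empty simplex is excluded since the barycentric coordinates sum to 1. *)
  have [i iS] : exists i, i \in S.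
    apply: contrapT => nS; have := oner_neq0 R; rewrite -p1 big1 ?eqxx // => i _.
    by apply: pS; apply/negP => iS; apply: nS; exists i.
  exists i; first exact: (seg S).
  by apply: Lsub LS; rewrite finset.sub1set.
exists [set i | connected_component X x (delta_mx 0 i)]; split.
- by have [i] := vert x Xx; exists i.
- have [i yi Li] := vert y Xy; exists i => // xi; apply: xy.
  by rewrite (same_connected_component xi) (same_connected_component yi).
- move=> a b /= xa xb Lab; apply: xb; apply: connected_component_trans xa _.
  apply: (seg _ _ _ Lab); rewrite ?finset.set22 //.
  + by move=> j; rewrite e0.
  + rewrite (bigD1 a) //= e0 eqxx big1 ?addr0 // => j /negPf ja.
    by rewrite e0 eq_sym ja.
  + by move=> j; rewrite e0 finset.in_set2 negb_or eq_sym => /andP[/negPf ->].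
Qed.

(** * Dipaths shortly before their end *)

(* Some coordinate in [A] is among the last to reach its final value. *)
Definition last_moves {R : realType} {n : nat} (K : set 'rV[R]_n)
    (y : 'rV[R]_n) (A : set 'I_n) :
    set {compact-open, set_type (@unit_itv R) -> set_type K} :=
  [set a : set_type (@unit_itv R) -> set_type K |
    exists t i, [/\ A i, forall j, y 0 j - 1 < \val (a t) 0 j &
                    \val (a t) 0 i < y 0 i]].

(** For a fixed time and coordinate, the condition sends a compact one-point set into an open set:
    it is subbasic in the compact-open topology. *)
Lemma last_moves_open {R : realType} {n : nat} (K : set 'rV[R]_n)
    (y : 'rV[R]_n) (A : set 'I_n) :
  open (last_moves (K := K) y A).
Proof.
pose O i := [set z : set_type K |
  (forall j, y 0 j - 1 < \val z 0 j) /\ \val z 0 i < y 0 i].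
have cc i : continuous (fun z : set_type K => \val z 0 i).
  by apply: coord_comp_continuous; exact: initial_continuous.
have oO i : open (O i).
  rewrite openE => z [yz zy].
  apply: filterI; last first.
    apply: (cc i z [set r | r < y 0 i]).
    by apply: open_nbhs_nbhs; split; [exact: open_lt|exact: zy].
  have yj j : nbhs z [set w : set_type K | y 0 j - 1 < \val w 0 j].
    apply: (cc j z [set r | y 0 j - 1 < r]).
    by apply: open_nbhs_nbhs; split; [exact: open_gt|exact: yz].
  exact: filter_forall yj.
rewrite (_ : last_moves (K := K) y A = \bigcup_(ti in [set ti | A ti.2])
  [set a : {compact-open, set_type (@unit_itv R) -> set_type K} |
    a @` [set ti.1] `<=` O ti.2]); last first.
  apply/seteqP; split=> a.
    by move=> [t [i [Ai ya ay]]]; exists (t, i) => // _ [_ -> <-].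
  move=> [[t i] /= Ai aO]; exists t, i.
  by have [] := aO (a t) (ex_intro2 _ _ t erefl erefl).
apply: bigcup_open => -[t i] _; apply: compact_open_open => //.
exact: compact_set1.
Qed.

(** The sup norm of [y - g t] falls from at least 1 to 0. When it equals 1/2, every coordinate is
    within 1 of its final value and some coordinate differs from it. *)
Lemma total_dipath_near_end {R : realType} {n : nat} (K : set 'rV[R]_n)
    (x y : 'rV[R]_n) (g : R -> 'rV[R]_n) :
  total_dipath K x y g -> (exists i, x 0 i + 1 <= y 0 i) ->
  exists2 t, 0 <= t <= 1 &
    (forall j, y 0 j - 1 < g t 0 j) /\ exists i, g t 0 i < y 0 i.
Proof.
move=> gP [i xyi]; have [gc _ g0 g1 _] := gP.
have coord_le_norm (M : 'rV[R]_n) j : `|M 0 j| <= `|M|.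
  by rewrite [leRHS]/Num.norm /= mx_normrE; apply/bigmax_geP; right; exists (0, j).
have [t t01 nt] : exists2 t, t \in `[0, 1] & `|y - g t| = 2^-1.
  apply: (@IVT R (fun t => `|y - g t|)) => //.
    apply: continuous_subspaceT => t; apply: cvg_norm.
    by apply: cvgB; [exact: cvg_cst|exact: gc].
  rewrite g0 g1 subrr normr0 ge_min le_max invr_ge0 ler0n orbT /=.
  apply/orP; left; apply: le_trans (coord_le_norm _ i).
  by rewrite !mxE (le_trans _ (ler_norm _)) //; lra.
exists t; first by move: t01; rewrite in_itv.
have [_ gy] := total_dipath_le gP t01.
split=> [j|].
  have := coord_le_norm (y - g t) j; rewrite nt !mxE => /(le_trans (ler_norm _)).
  by lra.
apply: contrapT => ng; suff yg : y = g t.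
  by move: nt; rewrite yg subrr normr0 => /esym/eqP; rewrite invr_eq0 pnatr_eq0.
apply/rowP => j; apply/le_anti; rewrite gy andbT leNgt; apply/negP => gj.
by apply: ng; exists j.
Qed.

(** Reach the lower end of the edge given by [a], then follow the edge; at its midpoint only
    coordinate [a] is off, by 1/2. *)
Lemma past_link_vertex_dipath {R : realType} {n : nat} (K : set 'rV[R]_n)
    (u v : 'rV[int]_n) (a : 'I_n) :
  past_link (reachable K u) u v [set a]%SET ->
  exists h t, [/\ total_dipath K (vecR u) (vecR v) h, 0 <= t <= 1,
    forall j, (v 0 j)%:~R - 1 < h t 0 j & h t 0 a < (v 0 a)%:~R].
Proof.
move=> La; pose y : 'rV[R]_n := vecR (v - indicator [set a]%SET).
pose d : 'rV[R]_n := vecR (indicator [set a]%SET).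
have d0 i : 0 <= d 0 i by rewrite !mxE ler0z.
have yd : y + d = vecR v.
  by apply/rowP => i; rewrite !mxE -intrD subrK.
have Kd (s : R) : 0 <= s <= 1 -> K (y + s *: d) /\ reachable K u (y + s *: d).
  move=> /andP[s0 s1]; suff H : reachable K u (y + s *: d).
    by split=> //; exact: reachable_sub H.
  have [] // := La (y + s *: d); split=> i; rewrite -?yd !mxE.
    by rewrite lerDl mulr_ge0 // ler0z.
  by rewrite lerD2l ler_piMl // ler0z.
have [_] : K (y + 0 *: d) /\ reachable K u (y + 0 *: d).
  by apply: Kd; rewrite lexx ler01.
rewrite scale0r addr0 => /reachableP[g gP].
have [h hP h34] := total_dipath_append gP d0 (fun s s01 => (Kd s s01).1).
exists h, (3 / 4); rewrite -yd; split=> //; first by lra.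
  move=> j; rewrite h34 !mxE intrB finset.in_set1.
  by case: (j == a) => /=; lra.
by rewrite h34 !mxE intrB finset.set11 /=; lra.
Qed.

Theorem theorem3 (R : realType) (n : nat) (K : set 'rV[R]_n)
  (hK : cubical_complex K) (h0 : vertices K 0)
  (v : 'rV[int]_n) (hv : vertices (reachable K 0) v)
  (hlink : disconnected (realization R (past_link (reachable K 0) 0 v))) :
  disconnected (dipath K (vecR 0) (vecR v)).
Proof.
have Lsub (S S' : {set 'I_n}) : S' \subset S ->
    past_link (reachable K 0) 0 v S -> past_link (reachable K 0) 0 v S'.
  exact: past_link_sub.
have [A [[a Aa La] [b Ab Lb] noedge]] := realization_disconnected_split Lsub hlink.
have near_end (B : set 'I_n) i : B i -> past_link (reachable K 0) 0 v [set i]%SET ->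
    dipath K (vecR 0) (vecR v) `&` last_moves (vecR v) B !=set0.
  move=> Bi /past_link_vertex_dipath[h [t [hP t01 vh hv']]].
  have [c cD ch] := total_dipath_restrict hP; exists c; split=> //.
  have tI : t \in @unit_itv R by rewrite inE /unit_itv /= in_itv.
  exists (exist (fun s => s \in @unit_itv R) t tI), i; rewrite ch /=.
  by split=> // [j|]; rewrite mxE.
apply: (disconnected_open (last_moves_open K (vecR v) A)
  (last_moves_open K (vecR v) (~` A)) _ _ (near_end A a Aa La)
  (near_end (~` A) b Ab Lb)).
- move=> c cD; have [g gP gc] := dipath_total cD.
  have [|t t01 [vg [i gi]]] := total_dipath_near_end gP.
    (* The lower end of the edge at [a] is reachable from 0, so coordinate [a] of [v] is at least
       1. *)
    exists a; have [|ra _] := La (vecR (v - indicator [set a]%SET)).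
      by split=> // i; rewrite !mxE ler_int gerBl; case: (_ \in _).
    by have := reachable_ge ra a; rewrite !mxE finset.set11 intrB /=; lra.
  have tI : t \in @unit_itv R by rewrite inE /unit_itv /= in_itv.
  pose s : set_type (@unit_itv R) := exist (fun s => s \in @unit_itv R) t tI.
  have [Ai|Ai] := pselect (A i); [left|right]; exists s, i; rewrite -gc.
  + by split.
  + by split.
- apply/seteqP; split=> // c [[cD [s [i [Ai vs si]]]] [t [j [Aj vt tj]]]].
  have [g gP gc] := dipath_total cD; have [_ gh _ _ _] := gP.
  (* If [i] and [j] were both unfinished at a time near the end, they would span an edge between [A]
     and its complement. *)
  have noface (r : set_type (@unit_itv R)) :
      (forall k, vecR v 0 k - 1 < g (\val r) 0 k) ->
      g (\val r) 0 i < vecR v 0 i -> g (\val r) 0 j < vecR v 0 j -> False.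
    move=> vr ri rj; apply: (noedge i j Ai Aj).
    have r01 : 0 <= \val r <= 1.
      by have := valP r; rewrite inE /unit_itv /= in_itv.
    have /andP[r0 _] := r01.
    apply: (past_link_near hK (total_dipath_reachable gP r0)).
    + by have [] := total_dipath_le gP r01.
    + by move=> k; have := vr k; rewrite mxE.
    + move=> k; rewrite finset.in_set2 => /orP[]/eqP->.
        by move: ri; rewrite mxE.
      by move: rj; rewrite mxE.
  rewrite -!gc in si tj.
  have vs' k : vecR v 0 k - 1 < g (\val s) 0 k by rewrite gc.
  have vt' k : vecR v 0 k - 1 < g (\val t) 0 k by rewrite gc.
  (* At the earlier of the two times both are unfinished, since the coordinates are monotone. *)
  have [st|/ltW ts] := leP (\val s) (\val t).
    exact: (noface s vs' si (le_lt_trans (gh _ _ st j) tj)).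
  exact: (noface t vt' (le_lt_trans (gh _ _ ts i) si) tj).
Qed.
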